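(* Let $T$ be a type, $\Gamma_{ext}=\mathit{in}:[T]^\omega,\ \mathit{out}:[T]^\omega$, and let $M$ be a resource environment containing the channels $\mathit{in},\mathit{out},b,d,c_1$. Then for every $n\in\mathbb N$, it is not the case that $\Gamma_{ext}\models M\triangleright\mathrm{Buff}\ \sqsubseteq^n_{bis}\ M\triangleright\mathrm{eBuff}$.
   Context: Calculus. Fix disjoint countably infinite sets $\mathcal C$ of channel names ($c,d$) and $\mathcal V$ of variables ($x,y,z,w$); identifiers $u,v$ range over $\mathcal C\cup\mathcal V$. Processes: $P,Q::= u!\langle\vec v\rangle.P \mid u?(\vec x).P\mid \mathbf 0\mid \mathsf{if}\ u=v\ \mathsf{then}\ P\ \mathsf{else}\ Q\mid \mathsf{rec}\,w.P\mid w\mid P\parallel Q\mid \mathsf{alloc}\,x.P\mid \mathsf{free}\,u.P$ (input binds $\vec x$, $\mathsf{rec}$ binds $w$, $\mathsf{alloc}$ binds $x$; no name restriction); $u!\langle\vec v\rangle$ abbreviates $u!\langle\vec v\rangle.\mathbf 0$. A resource environment $M$ is a set of allocated channels (infinitely many unallocated); $M,c$ denotes $M\cup\{c\}$ with $c\notin M$. A system $M\triangleright P$ pairs a resource environment with a closed process. Types: attributes $a::=\omega\mid1\mid\bullet i$ ($i\in\mathbb N$, $\bullet=\bullet0$); types $T::=U\mid\mathsf{proc}$, $U::=[\vec U]^a\mid\mu X.U\mid X$, closed contractive, up to equi-recursive equality $\sim$. Environments $\Gamma$: finite multisets of $u:T$. Splitting $[\vec T]^\omega=[\vec T]^\omega\circ[\vec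 T]^\omega$, $\mathsf{proc}=\mathsf{proc}\circ\mathsf{proc}$, $[\vec T]^{\bullet i}=[\vec T]^1\circ[\vec T]^{\bullet(i+1)}$; subtyping generated by $\bullet i\preceq\bullet(i+1)$, $\bullet i\preceq\omega$, $\omega\preceq1$ lifted to channel types. $\prec$: least reflexive transitive relation with $\Gamma,u:T\prec\Gamma,u:T_1,u:T_2$ and converse when $T=T_1\circ T_2$; $\Gamma,u:T_1\prec\Gamma,u:T_2$ when $T_1\sim T_2$ or $T_1\preceq T_2$; $\Gamma,u:T\prec\Gamma$; $\Gamma,u:[\vec T_1]^\bullet\prec\Gamma,u:[\vec T_2]^\bullet$. Decrement $(u:[\vec T]^a-1)$: empty if $a=1$, $u:[\vec T]^\omega$ if $a=\omega$, $u:[\vec T]^{\bullet i}$ if $a=\bullet(i+1)$, undefined if $a=\bullet$. Typing $\Gamma\vdash P$: $\Gamma,(u:[\vec T]^a-1)\vdash P\Rightarrow\Gamma,u:[\vec T]^a,\vec v:\vec T\vdash u!\langle\vec v\rangle.P$; $\Gamma,(u:[\vec T]^a-1),\vec x:\vec T\vdash P\Rightarrow\Gamma,u:[\vec T]^a\vdash u?(\vec x).P$; $\Gamma_1\vdash P,\Gamma_2\vdash Q\Rightarrow\Gamma_1,\Gamma_2\vdash P\parallel Q$; $u,v\in\mathrm{dom}(\Gamma),\Gamma\vdash P,\Gamma\vdash Q\Rightarrow\Gamma\vdash\mathsf{if}\ u=v\ \mathsf{then}\ P\ \mathsf{else}\ Q$; $\Gamma^\omega,w:\mathsf{proc}\vdash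 P\Rightarrow\Gamma^\omega\vdash\mathsf{rec}\,w.P$ ($\Gamma^\omega$ only unrestricted assumptions); $w:\mathsf{proc}\vdash w$; $\Gamma\vdash P\Rightarrow\Gamma,u:[\vec T]^\bullet\vdash\mathsf{free}\,u.P$; $\Gamma,x:[\vec T]^\bullet\vdash P\Rightarrow\Gamma\vdash\mathsf{alloc}\,x.P$; $\emptyset\vdash\mathbf0$; $\Gamma'\vdash P,\Gamma\prec\Gamma'\Rightarrow\Gamma\vdash P$. $\Gamma$ consistent iff some $\Gamma'$ with each identifier at most once has $\Gamma'\prec\Gamma$. $\Gamma\vdash M\triangleright P$ iff $\Gamma\vdash P$, $\mathrm{dom}(\Gamma)\subseteq M$, $\Gamma$ consistent. Configuration $\Gamma\triangleleft M\triangleright P$: $\mathrm{dom}(\Gamma)\subseteq M$ and some $\Delta$ with $(\Gamma,\Delta)$ consistent and $\Delta\vdash M\triangleright P$. LTS: pre-transitions $\Gamma\triangleleft M\triangleright P\xrightarrow{\mu}{}^{\mathrm{pre}}_k\Gamma'\triangleleft M'\triangleright P'$, $\mu::=c!\vec d\mid c?\vec d\mid\tau\mid\mathsf{alloc}\mid\mathsf{free}\,c\mid\mathsf{env}$: output $\Gamma,c:[\vec T]^a\triangleleft M\triangleright c!\langle\vec d\rangle.P\xrightarrow{c!\vec d}_0\Gamma,(c:[\vec T]^a-1),\vec d:\vec T\triangleleft M\triangleright P$; input $\Gamma,c:[\vec T]^a,\vec d:\vec T\triangleleft M\triangleright c?(\vec x).P\xrightarrow{c?\vec d}_0\Gamma,(c:[\vec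 T]^a-1)\triangleleft M\triangleright P\{\vec d/\vec x\}$; communication: if $\Gamma_1\triangleleft M\triangleright P\xrightarrow{c!\vec d}_0\Gamma'_1\triangleleft M\triangleright P'$ and $\Gamma_2\triangleleft M\triangleright Q\xrightarrow{c?\vec d}_0\Gamma'_2\triangleleft M\triangleright Q'$ then $\Gamma\triangleleft M\triangleright P\parallel Q\xrightarrow{\tau}_0\Gamma\triangleleft M\triangleright P'\parallel Q'$ for any $\Gamma$ (and symmetrically); parallel closure on either side; $\Gamma\triangleleft M\triangleright P\xrightarrow{\mathsf{env}}_0\Gamma'\triangleleft M\triangleright P$ for $\Gamma\prec\Gamma'$; cost-0 $\tau$ for recursion unfolding and conditionals (then-branch for $\mathsf{if}\ c=c$, $c\in M$; else-branch for $\mathsf{if}\ c=d$, $c\neq d$, $c,d\in M$); $\Gamma\triangleleft M\triangleright\mathsf{alloc}\,x.P\xrightarrow{\tau}_{+1}\Gamma\triangleleft M,c\triangleright P\{c/x\}$; $\Gamma\triangleleft M\triangleright P\xrightarrow{\mathsf{alloc}}_{+1}\Gamma,c:[\vec T]^\bullet\triangleleft M,c\triangleright P$; $\Gamma\triangleleft M,c\triangleright\mathsf{free}\,c.P\xrightarrow{\tau}_{-1}\Gamma\triangleleft M\triangleright P$; $\Gamma,c:[\vec T]^\bullet\triangleleft M,c\triangleright P\xrightarrow{\mathsf{free}\,c}_{-1}\Gamma\triangleleft M\triangleright P$. Transitions $\Gamma\triangleleft M\triangleright P\xrightarrow{\mu}_kX$ iff $\Gamma\triangleleft(M\triangleright P)\sigma\xrightarrow{\mu}{}^{\mathrm{pre}}_kX$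 for some bijective renaming $\sigma$ of channels fixing all channels in $\mathrm{dom}(\Gamma)$. Weak $\xRightarrow{\mu}_k$: $\tau$-steps, one $\mu$-step, $\tau$-steps, total cost $k$; $\hat\mu=\mu$ for $\mu\ne\tau$, and $\xRightarrow{\hat\tau}_k$ is zero or more $\tau$-steps of total cost $k$. Bisimulation: an amortised typed bisimulation is a set $\mathcal R$ of quadruples $(\Gamma,n,S,T)$, $n\in\mathbb N$, with $\Gamma\triangleleft S,\Gamma\triangleleft T$ configurations, such that whenever $(\Gamma,n,M\triangleright P,N\triangleright Q)\in\mathcal R$: each $\Gamma\triangleleft M\triangleright P\xrightarrow{\mu}_k\Gamma'\triangleleft M'\triangleright P'$ is matched by some $\Gamma\triangleleft N\triangleright Q\xRightarrow{\hat\mu}_l\Gamma'\triangleleft N'\triangleright Q'$ with $(\Gamma',n+l-k,M'\triangleright P',N'\triangleright Q')\in\mathcal R$, and each $\Gamma\triangleleft N\triangleright Q\xrightarrow{\mu}_l\Gamma'\triangleleft N'\triangleright Q'$ is matched by some $\Gamma\triangleleft M\triangleright P\xRightarrow{\hat\mu}_k\Gamma'\triangleleft M'\triangleright P'$ with $(\Gamma',n+l-k,M'\triangleright P',N'\triangleright Q')\in\mathcal R$ (credits stay in $\mathbb N$). $\Gamma\models S\sqsubseteq^n_{bis}T$ iff some amortised typed bisimulation contains $(\Gamma,n,S,T)$. Buffers (with $\mathit{in},\mathit{out},b,d,c_1$ distinct channels): $\mathrm{Frn}=\mathsf{rec}\,w.\,b?(x).\,\mathit{in}?(y).\,\mathsf{alloc}\,z.(w\parallel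 b!\langle z\rangle\parallel x!\langle y,z\rangle)$; $\mathrm{Bck}=\mathsf{rec}\,w.\,d?(x).\,x?(y,z).\,\mathit{out}!\langle y\rangle.(w\parallel d!\langle z\rangle)$; $\mathrm{eBk}=\mathsf{rec}\,w.\,d?(x).\,x?(y,z).\,\mathsf{free}\,x.\,\mathit{out}!\langle y\rangle.(w\parallel d!\langle z\rangle)$; $\mathrm{Buff}=\mathit{in}?(y).\mathsf{alloc}\,z.(\mathrm{Frn}\parallel b!\langle z\rangle\parallel c_1!\langle y,z\rangle)\parallel c_1?(y,z).\mathit{out}!\langle y\rangle.(\mathrm{Bck}\parallel d!\langle z\rangle)$; $\mathrm{eBuff}=\mathit{in}?(y).\mathsf{alloc}\,z.(\mathrm{Frn}\parallel b!\langle z\rangle\parallel c_1!\langle y,z\rangle)\parallel c_1?(y,z).\mathsf{free}\,c_1.\mathit{out}!\langle y\rangle.(\mathrm{eBk}\parallel d!\langle z\rangle)$. *)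

(* Defs.v *)
From HB Require Import structures.
From mathcomp Require Import all_boot all_order all_algebra.
From mathcomp Require Import finmap multiset.
From mathcomp Require Import boolp classical_sets cardinality.

Set Implicit Arguments.
Unset Strict Implicit.
Unset Printing Implicit Defensive.

Import GRing.Theory.
Local Open Scope nat_scope.

Definition channel : Type := nat.
HB.instance Definition _ := Countable.copy channel nat.

Definition var : Type := nat.
HB.instance Definition _ := Countable.copy var nat.

Inductive ident : Type := Ch of channel | Va of var.

Definition sum_of_ident (u : ident) : (channel + var)%type :=
  match u with Ch c => inl c | Va x => inr x end.
Definition ident_of_sum (s : channel + var) : ident :=
  match s with inl c => Ch c | inr x => Va x end.
Lemma sum_of_identK : cancel sum_of_ident ident_of_sum.
Proof. by case. Qed.
HB.instance Definition _ := Countable.copy ident (can_type sum_of_identK).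

Inductive proc : Type :=
| POut of ident & seq ident & proc        (* u!<vs>.P *)
| PIn of ident & seq var & proc           (* u?(xs).P *)
| PNil
| PIf of ident & ident & proc & proc      (* if u = v then P else Q *)
| PRec of var & proc                      (* rec w.P *)
| PVar of var                            (* w *)
| PPar of proc & proc
| PAlloc of var & proc                    (* alloc x.P *)
| PFree of ident & proc.                  (* free u.P *)

Definition closed_ident (xs : seq var) (u : ident) : bool :=
  if u is Va x then x \in xs else true.

(* the free variables of P are among xs *)
Fixpoint closed_in (xs : seq var) (P : proc) : bool :=
  match P with
  | POut u vs P => [&& closed_ident xs u, all (closed_ident xs) vs & closed_in xs P]
  | PIn u ys P => closed_ident xs u && closed_in (ys ++ xs) P
  | PNil => true
  | PIf u v P Q =>
      [&& closed_ident xs u, closed_ident xs v, closed_in xs P & closed_in xs Q]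
  | PRec w P => closed_in (w :: xs) P
  | PVar w => w \in xs
  | PPar P Q => closed_in xs P && closed_in xs Q
  | PAlloc x P => closed_in (x :: xs) P
  | PFree u P => closed_ident xs u && closed_in xs P
  end.

Definition closed_proc : proc -> bool := closed_in [::].

(* Substitutions only ever replace variables by channels (which are never
   bound), or a process variable by a closed process, so no capture can occur
   and no renaming of bound variables is needed. *)
Definition vsubst := var -> ident.

Definition hide_vars (xs : seq var) (s : vsubst) : vsubst :=
  fun y => if y \in xs then Va y else s y.

Definition isubst (s : vsubst) (u : ident) : ident :=
  if u is Va x then s x else u.

Fixpoint psubst (s : vsubst) (P : proc) : proc :=
  match P with
  | POut u vs P => POut (isubst s u) (map (isubst s) vs) (psubst s P)
  | PIn u ys P => PIn (isubst s u) ys (psubst (hide_vars ys s) P)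
  | PNil => PNil
  | PIf u v P Q => PIf (isubst s u) (isubst s v) (psubst s P) (psubst s Q)
  | PRec w P => PRec w (psubst (hide_vars [:: w] s) P)
  | PVar w => PVar w
  | PPar P Q => PPar (psubst s P) (psubst s Q)
  | PAlloc x P => PAlloc x (psubst (hide_vars [:: x] s) P)
  | PFree u P => PFree (isubst s u) (psubst s P)
  end.

(* P{ds/xs}; when size ds = size xs, variables outside xs are left unchanged *)
Definition subst_chans (xs : seq var) (ds : seq channel) (P : proc) : proc :=
  psubst (fun y => nth (Va y) (map Ch ds) (index y xs)) P.

(* P{Q/w} *)
Fixpoint subst_proc (w : var) (Q : proc) (P : proc) : proc :=
  match P with
  | POut u vs P => POut u vs (subst_proc w Q P)
  | PIn u ys P => PIn u ys (if w \in ys then P else subst_proc w Q P)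
  | PNil => PNil
  | PIf u v P1 P2 => PIf u v (subst_proc w Q P1) (subst_proc w Q P2)
  | PRec w' P => PRec w' (if w == w' then P else subst_proc w Q P)
  | PVar w' => if w == w' then Q else PVar w'
  | PPar P1 P2 => PPar (subst_proc w Q P1) (subst_proc w Q P2)
  | PAlloc x P => PAlloc x (if w == x then P else subst_proc w Q P)
  | PFree u P => PFree u (subst_proc w Q P)
  end.

Definition irename (r : channel -> channel) (u : ident) : ident :=
  if u is Ch c then Ch (r c) else u.

Fixpoint prename (r : channel -> channel) (P : proc) : proc :=
  match P with
  | POut u vs P => POut (irename r u) (map (irename r) vs) (prename r P)
  | PIn u ys P => PIn (irename r u) ys (prename r P)
  | PNil => PNil
  | PIf u v P Q => PIf (irename r u) (irename r v) (prename r P) (prename r Q)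
  | PRec w P => PRec w (prename r P)
  | PVar w => PVar w
  | PPar P Q => PPar (prename r P) (prename r Q)
  | PAlloc x P => PAlloc x (prename r P)
  | PFree u P => PFree (irename r u) (prename r P)
  end.

Inductive attr : Type :=
| Unr          (* omega *)
| Aff          (* 1 *)
| Unq of nat.  (* bullet i *)

(* type variables are de Bruijn indices *)
Inductive pretype : Type :=
| TChan of seq pretype & attr
| TMu of pretype
| TVar of nat.

Fixpoint tclosed (n : nat) (t : pretype) : bool :=
  match t with
  | TChan ts _ => all (tclosed n) ts
  | TMu t => tclosed n.+1 t
  | TVar m => m < n
  end.

(* t is mu X_1 ... mu X_k. X, where X is the variable with index n outside t *)
Fixpoint tunguarded (n : nat) (t : pretype) : bool :=
  match t with
  | TChan _ _ => false
  | TMu t => tunguarded n.+1 t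
  | TVar m => m == n
  end.

Fixpoint contractive (t : pretype) : bool :=
  match t with
  | TChan ts _ => all contractive ts
  | TMu t => ~~ tunguarded 0 t && contractive t
  | TVar _ => true
  end.

(* replaces index k by s; used only with s closed and t with no free index
   greater than k, so that no index needs to be shifted *)
Fixpoint tsubst (k : nat) (s t : pretype) : pretype :=
  match t with
  | TChan ts a => TChan (map (tsubst k s) ts) a
  | TMu t => TMu (tsubst k.+1 s t)
  | TVar m => if m == k then s else TVar m
  end.

(* t unfolds to [ts]^a *)
Inductive tunfold : pretype -> seq pretype -> attr -> Prop :=
| tunfold_chan ts a : tunfold (TChan ts a) ts a
| tunfold_mu t ts a : tunfold (tsubst 0 (TMu t) t) ts a -> tunfold (TMu t) ts a.

Definition tree_bisim (R : pretype -> pretype -> Prop) : Prop :=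
  forall t u, R t u ->
    exists ts us a,
      [/\ tunfold t ts a, tunfold u us a, size ts = size us &
          forall i, i < size ts -> R (nth (TVar 0) ts i) (nth (TVar 0) us i)].

(* equi-recursive equality: equality of the infinite trees *)
Definition pretype_eq (t u : pretype) : Prop := exists2 R, tree_bisim R & R t u.

Fixpoint tree_of_pretype (t : pretype) : GenTree.tree nat :=
  match t with
  | TChan ts Unr => GenTree.Node 0 (map tree_of_pretype ts)
  | TChan ts Aff => GenTree.Node 1 (map tree_of_pretype ts)
  | TChan ts (Unq i) => GenTree.Node i.+3 (map tree_of_pretype ts)
  | TMu t => GenTree.Node 2 [:: tree_of_pretype t]
  | TVar m => GenTree.Leaf m
  end.

Fixpoint pretype_of_tree (t : GenTree.tree nat) : pretype :=
  match t with
  | GenTree.Leaf m => TVar m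
  | GenTree.Node 0 ts => TChan (map pretype_of_tree ts) Unr
  | GenTree.Node 1 ts => TChan (map pretype_of_tree ts) Aff
  | GenTree.Node 2 ts => TMu (head (TVar 0) (map pretype_of_tree ts))
  | GenTree.Node i.+3 ts => TChan (map pretype_of_tree ts) (Unq i)
  end.

Lemma tree_of_pretypeK : cancel tree_of_pretype pretype_of_tree.
Proof.
rewrite /cancel; fix IH 1; case=> [ts a|t|m] /=; [|by rewrite IH|by []].
have E : map pretype_of_tree (map tree_of_pretype ts) = ts.
  by elim: ts => [//|t ts IHts] /=; rewrite IH IHts.
by case: a => [||i] /=; rewrite E.
Qed.
HB.instance Definition _ := Countable.copy pretype (can_type tree_of_pretypeK).

(* the closed contractive channel types U *)
Definition ctype : Type := {t : pretype | tclosed 0 t && contractive t}.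
HB.instance Definition _ := Countable.on ctype.

Lemma chan_subproof (ts : seq ctype) (a : attr) :
  tclosed 0 (TChan (map val ts) a) && contractive (TChan (map val ts) a).
Proof.
by elim: ts => [//|[t /= /andP[tc tg]] ts /andP[/= -> ->]]; rewrite tc tg.
Qed.

(* [ts]^a *)
Definition chan (ts : seq ctype) (a : attr) : ctype :=
  exist _ (TChan (map val ts) a) (chan_subproof ts a).

Inductive type : Type := TU of ctype | TProc.

Definition option_of_type (T : type) : option ctype :=
  if T is TU U then Some U else None.
Definition type_of_option (o : option ctype) : type :=
  if o is Some U then TU U else TProc.
Lemma option_of_typeK : cancel option_of_type type_of_option.
Proof. by case. Qed.
HB.instance Definition _ := Countable.copy type (can_type option_of_typeK).

Definition tchan (ts : seq ctype) (a : attr) : type := TU (chan ts a).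

Definition type_eq (T1 T2 : type) : Prop :=
  match T1, T2 with
  | TU U1, TU U2 => pretype_eq (val U1) (val U2)
  | TProc, TProc => True
  | _, _ => False
  end.

(* tsplit T T1 T2 is T = T1 o T2 *)
Inductive tsplit : type -> type -> type -> Prop :=
| tsplit_unr ts : tsplit (tchan ts Unr) (tchan ts Unr) (tchan ts Unr)
| tsplit_proc : tsplit TProc TProc TProc
| tsplit_unq ts i : tsplit (tchan ts (Unq i)) (tchan ts Aff) (tchan ts (Unq i.+1)).

Inductive attr_sub : attr -> attr -> Prop :=
| attr_sub_refl a : attr_sub a a
| attr_sub_trans a1 a2 a3 : attr_sub a1 a2 -> attr_sub a2 a3 -> attr_sub a1 a3
| attr_sub_index i : attr_sub (Unq i) (Unq i.+1)
| attr_sub_unq i : attr_sub (Unq i) Unr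
| attr_sub_aff : attr_sub Unr Aff.

Inductive type_sub : type -> type -> Prop :=
| type_sub_chan ts a1 a2 : attr_sub a1 a2 -> type_sub (tchan ts a1) (tchan ts a2).

Local Open Scope mset_scope.

Definition env : Type := {mset (ident * type)%type}.

Definition dom (G : env) : set ident := [set u | exists T, (u, T) \in G]%classic.

Inductive env_struct : env -> env -> Prop :=
| es_refl (G : env) : env_struct G G
| es_trans (G1 G2 G3 : env) : env_struct G1 G2 -> env_struct G2 G3 -> env_struct G1 G3
| es_contract (G : env) (u : ident) (T T1 T2 : type) : tsplit T T1 T2 ->
    env_struct (G `+` [mset (u, T)]) (G `+` [mset (u, T1)] `+` [mset (u, T2)])
| es_join (G : env) (u : ident) (T T1 T2 : type) : tsplit T T1 T2 ->
    env_struct (G `+` [mset (u, T1)] `+` [mset (u, T2)]) (G `+` [mset (u, T)])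
| es_eq (G : env) (u : ident) (T1 T2 : type) : type_eq T1 T2 ->
    env_struct (G `+` [mset (u, T1)]) (G `+` [mset (u, T2)])
| es_sub (G : env) (u : ident) (T1 T2 : type) : type_sub T1 T2 ->
    env_struct (G `+` [mset (u, T1)]) (G `+` [mset (u, T2)])
| es_weak (G : env) (u : ident) (T : type) : env_struct (G `+` [mset (u, T)]) G
| es_rev (G : env) (u : ident) ts1 ts2 :
    env_struct (G `+` [mset (u, tchan ts1 (Unq 0))])
               (G `+` [mset (u, tchan ts2 (Unq 0))]).

(* (u : [ts]^a - 1), where None stands for undefined *)
Definition decr (u : ident) (ts : seq ctype) (a : attr) : option env :=
  match a with
  | Aff => Some mset0
  | Unr => Some [mset (u, tchan ts Unr)]
  | Unq i.+1 => Some [mset (u, tchan ts (Unq i))]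
  | Unq 0 => None
  end.

(* vs : ts, used with size vs = size ts *)
Definition assume (vs : seq ident) (ts : seq ctype) : env :=
  seq_mset (zip vs (map TU ts)).

Definition unrestricted (G : env) : Prop :=
  forall u T, (u, T) \in G -> T = TProc \/ exists ts, T = tchan ts Unr.

(* The freshness and uniq conditions on bound variables implement the convention
   that processes are taken up to alpha-conversion and that bound variables are
   distinct; an assumption about a shadowed variable can be weakened away. *)
Inductive typed : env -> proc -> Prop :=
| ty_out (G D : env) u ts a vs P :
    decr u ts a = Some D -> size vs = size ts ->
    typed (G `+` D) P ->
    typed (G `+` [mset (u, tchan ts a)] `+` assume vs ts) (POut u vs P)
| ty_in (G D : env) u ts a xs P :
    decr u ts a = Some D -> size xs = size ts -> uniq xs ->
    (forall x, x \in xs -> ~ dom (G `+` D) (Va x)) ->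
    typed (G `+` D `+` assume (map Va xs) ts) P ->
    typed (G `+` [mset (u, tchan ts a)]) (PIn u xs P)
| ty_par (G1 G2 : env) P Q : typed G1 P -> typed G2 Q -> typed (G1 `+` G2) (PPar P Q)
| ty_if (G : env) u v P Q : dom G u -> dom G v -> typed G P -> typed G Q ->
    typed G (PIf u v P Q)
| ty_rec (G : env) w P : unrestricted G -> ~ dom G (Va w) ->
    typed (G `+` [mset (Va w, TProc)]) P -> typed G (PRec w P)
| ty_var w : typed [mset (Va w, TProc)] (PVar w)
| ty_free (G : env) (u : ident) ts P : typed G P ->
    typed (G `+` [mset (u, tchan ts (Unq 0))]) (PFree u P)
| ty_alloc (G : env) x ts P : ~ dom G (Va x) ->
    typed (G `+` [mset (Va x, tchan ts (Unq 0))]) P -> typed G (PAlloc x P)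
| ty_nil : typed mset0 PNil
| ty_struct (G G' : env) P : typed G' P -> env_struct G G' -> typed G P.

Definition functional_env (G : env) : Prop := uniq (map fst (enum_mset G)).

Definition consistent (G : env) : Prop :=
  exists2 G', functional_env G' & env_struct G' G.

Definition resource_env (M : set channel) : Prop := infinite_set (~` M)%classic.

Record system : Type := Sys { renv : set channel; sproc : proc }.

Definition wf_system (S : system) : Prop :=
  resource_env (renv S) /\ closed_proc (sproc S).

Definition dom_in (G : env) (M : set channel) : Prop :=
  (dom G `<=` Ch @` M)%classic.

Definition typed_system (G : env) (S : system) : Prop :=
  [/\ typed G (sproc S), dom_in G (renv S) & consistent G].

Definition configuration (G : env) (S : system) : Prop :=
  [/\ wf_system S, dom_in G (renv S) &
      exists D, consistent (G `+` D) /\ typed_system D S].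

Inductive label : Type :=
| LOut of channel & seq channel
| LIn of channel & seq channel
| LTau
| LAlloc
| LFree of channel
| LEnv.

(* G <| M |> P *)
Record conf : Type := Conf { cenv : env; cres : set channel; cproc : proc }.

(* M, c is (c |` M) together with the side condition ~ M c *)
Inductive pretrans : conf -> label -> int -> conf -> Prop :=
| pt_out (G D : env) M c ts a ds P :
    decr (Ch c) ts a = Some D -> size ds = size ts ->
    pretrans (Conf (G `+` [mset (Ch c, tchan ts a)]) M (POut (Ch c) (map Ch ds) P))
             (LOut c ds) 0%R
             (Conf (G `+` D `+` assume (map Ch ds) ts) M P)
| pt_in (G D : env) M c ts a ds xs P :
    decr (Ch c) ts a = Some D -> size ds = size ts -> size ds = size xs ->
    pretrans (Conf (G `+` [mset (Ch c, tchan ts a)] `+` assume (map Ch ds) ts) M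
                   (PIn (Ch c) xs P))
             (LIn c ds) 0%R
             (Conf (G `+` D) M (subst_chans xs ds P))
| pt_com_l (G G1 G1' G2 G2' : env) M c ds P P' Q Q' :
    pretrans (Conf G1 M P) (LOut c ds) 0%R (Conf G1' M P') ->
    pretrans (Conf G2 M Q) (LIn c ds) 0%R (Conf G2' M Q') ->
    pretrans (Conf G M (PPar P Q)) LTau 0%R (Conf G M (PPar P' Q'))
| pt_com_r (G G1 G1' G2 G2' : env) M c ds P P' Q Q' :
    pretrans (Conf G1 M P) (LIn c ds) 0%R (Conf G1' M P') ->
    pretrans (Conf G2 M Q) (LOut c ds) 0%R (Conf G2' M Q') ->
    pretrans (Conf G M (PPar P Q)) LTau 0%R (Conf G M (PPar P' Q'))
| pt_par_l (G G' : env) M M' P P' Q mu k :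
    pretrans (Conf G M P) mu k (Conf G' M' P') ->
    pretrans (Conf G M (PPar P Q)) mu k (Conf G' M' (PPar P' Q))
| pt_par_r (G G' : env) M M' P Q Q' mu k :
    pretrans (Conf G M Q) mu k (Conf G' M' Q') ->
    pretrans (Conf G M (PPar P Q)) mu k (Conf G' M' (PPar P Q'))
| pt_env (G G' : env) M P : env_struct G G' ->
    pretrans (Conf G M P) LEnv 0%R (Conf G' M P)
| pt_rec (G : env) M w P :
    pretrans (Conf G M (PRec w P)) LTau 0%R (Conf G M (subst_proc w (PRec w P) P))
| pt_then (G : env) (M : set channel) c P Q : M c ->
    pretrans (Conf G M (PIf (Ch c) (Ch c) P Q)) LTau 0%R (Conf G M P)
| pt_else (G : env) (M : set channel) c d P Q : c <> d -> M c -> M d ->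
    pretrans (Conf G M (PIf (Ch c) (Ch d) P Q)) LTau 0%R (Conf G M Q)
| pt_alloc (G : env) (M : set channel) c x P : ~ M c ->
    pretrans (Conf G M (PAlloc x P)) LTau 1%R
             (Conf G (c |` M)%classic (subst_chans [:: x] [:: c] P))
| pt_ext_alloc (G : env) (M : set channel) c ts P : ~ M c ->
    pretrans (Conf G M P) LAlloc 1%R
             (Conf (G `+` [mset (Ch c, tchan ts (Unq 0))]) (c |` M)%classic P)
| pt_free (G : env) (M : set channel) c P : ~ M c ->
    pretrans (Conf G (c |` M)%classic (PFree (Ch c) P)) LTau (-1)%R (Conf G M P)
| pt_ext_free (G : env) (M : set channel) c ts P : ~ M c ->
    pretrans (Conf (G `+` [mset (Ch c, tchan ts (Unq 0))]) (c |` M)%classic P)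
             (LFree c) (-1)%R (Conf G M P).

Definition trans (X : conf) (mu : label) (k : int) (Y : conf) : Prop :=
  exists r : channel -> channel,
    [/\ bijective r,
        forall c, dom (cenv X) (Ch c) -> r c = c &
        pretrans (Conf (cenv X) (r @` cres X)%classic (prename r (cproc X))) mu k Y].

Inductive taus : conf -> int -> conf -> Prop :=
| taus_nil X : taus X 0%R X
| taus_cons X Y Z k l : trans X LTau k Y -> taus Y l Z -> taus X (k + l)%R Z.

Definition weak (X : conf) (mu : label) (k : int) (Y : conf) : Prop :=
  exists X' Y' k1 k2 k3,
    [/\ taus X k1 X', trans X' mu k2 Y', taus Y' k3 Y & k = (k1 + k2 + k3)%R].

Definition weak_hat (X : conf) (mu : label) (k : int) (Y : conf) : Prop :=
  if mu is LTau then taus X k Y else weak X mu k Y.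

Definition sconf (G : env) (S : system) : conf := Conf G (renv S) (sproc S).

Definition amortised_bisimulation (R : env -> nat -> system -> system -> Prop) : Prop :=
  forall G n S T, R G n S T ->
    [/\ configuration G S, configuration G T,
        forall mu k G' S', trans (sconf G S) mu k (sconf G' S') ->
          exists l T' (n' : nat),
            [/\ weak_hat (sconf G T) mu l (sconf G' T'),
                (n'%:Z = n%:Z + l - k)%R & R G' n' S' T'] &
        forall mu l G' T', trans (sconf G T) mu l (sconf G' T') ->
          exists k S' (n' : nat),
            [/\ weak_hat (sconf G S) mu k (sconf G' S'),
                (n'%:Z = n%:Z + l - k)%R & R G' n' S' T']].

Definition bis_le (G : env) (n : nat) (S T : system) : Prop :=
  exists2 R, amortised_bisimulation R & R G n S T.

Definition vw : var := 0.
Definition vx : var := 1.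
Definition vy : var := 2.
Definition vz : var := 3.

Definition Frn (cin b : channel) : proc :=
  PRec vw (PIn (Ch b) [:: vx] (PIn (Ch cin) [:: vy] (PAlloc vz
    (PPar (PPar (PVar vw) (POut (Ch b) [:: Va vz] PNil))
         (POut (Va vx) [:: Va vy; Va vz] PNil))))).

Definition Bck (cout d : channel) : proc :=
  PRec vw (PIn (Ch d) [:: vx] (PIn (Va vx) [:: vy; vz]
    (POut (Ch cout) [:: Va vy] (PPar (PVar vw) (POut (Ch d) [:: Va vz] PNil))))).

Definition eBk (cout d : channel) : proc :=
  PRec vw (PIn (Ch d) [:: vx] (PIn (Va vx) [:: vy; vz] (PFree (Va vx)
    (POut (Ch cout) [:: Va vy] (PPar (PVar vw) (POut (Ch d) [:: Va vz] PNil)))))).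

Definition Buff (cin cout b d c1 : channel) : proc :=
  PPar (PIn (Ch cin) [:: vy] (PAlloc vz
        (PPar (PPar (Frn cin b) (POut (Ch b) [:: Va vz] PNil))
             (POut (Ch c1) [:: Va vy; Va vz] PNil))))
      (PIn (Ch c1) [:: vy; vz] (POut (Ch cout) [:: Va vy]
        (PPar (Bck cout d) (POut (Ch d) [:: Va vz] PNil)))).

Definition eBuff (cin cout b d c1 : channel) : proc :=
  PPar (PIn (Ch cin) [:: vy] (PAlloc vz
        (PPar (PPar (Frn cin b) (POut (Ch b) [:: Va vz] PNil))
             (POut (Ch c1) [:: Va vy; Va vz] PNil))))
      (PIn (Ch c1) [:: vy; vz] (PFree (Ch c1) (POut (Ch cout) [:: Va vy]
        (PPar (eBk cout d) (POut (Ch d) [:: Va vz] PNil))))).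

Definition Gext (cin cout : channel) (T : ctype) : env :=
  [mset (Ch cin, tchan [:: T] Unr)] `+` [mset (Ch cout, tchan [:: T] Unr)].

(* Main.v *)
(** Assign credits to the efficient buffer: receiving an input earns one, an
    allocation spends one, a deallocation earns one, an output on [cout] spends
    one.  A syntactic discipline shows that its credits never become negative,
    so the sum of the amortisation credit and these credits only depends on the
    moves of the other player.  Driving the leaky buffer through one input, one
    allocation and one output lowers this sum by one, and the buffer can be
    driven forever with a single value, since the output returns it to the
    observer. *)
Require Import Defs.
From mathcomp Require Import all_boot all_order all_algebra.
From mathcomp Require Import finmap multiset.
From mathcomp Require Import boolp classical_sets cardinality.
From mathcomp Require Import zify.

Set Implicit Arguments.
Unset Strict Implicit.
Unset Printing Implicit Defensive.

Import GRing.Theory.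
Local Open Scope nat_scope.
Local Open Scope mset_scope.

(** * Unfolding of types *)

Lemma pretype_nested_ind (Q : pretype -> Prop) :
    (forall ts a, (forall t, t \in ts -> Q t) -> Q (TChan ts a)) ->
    (forall t, Q t -> Q (TMu t)) -> (forall m, Q (TVar m)) ->
  forall t, Q t.
Proof.
move=> Qchan Qmu Qvar; fix IH 1; case=> [ts a|t|m]; [|exact/Qmu/IH|exact: Qvar].
apply: Qchan; elim: ts => [|t ts IHts] u; rewrite inE; first discriminate.
by case/orP => [/eqP->|uts]; [exact: IH | exact: IHts].
Qed.

Lemma tclosed_leq t m n : m <= n -> tclosed m t -> tclosed n t.
Proof.
elim/pretype_nested_ind: t m n => [ts a IH|t IH|k] m n lemn /=.
- by move=> /allP ct; apply/allP => t tts; apply: IH (ct t tts).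
- exact: IH.
- by move=> ltkm; apply: leq_trans lemn.
Qed.

Lemma tclosed_tunguarded t m n : m <= n -> tclosed m t -> tunguarded n t = false.
Proof.
elim/pretype_nested_ind: t m n => [//|t IH|k] m n lemn /=.
- exact: IH.
- by move=> ltkm; apply/eqP; lia.
Qed.

Lemma tclosed_tsubst n s t :
  tclosed 0 s -> tclosed n.+1 t -> tclosed n (tsubst n s t).
Proof.
move=> cs; elim/pretype_nested_ind: t n => [ts a IH|t IH|k] n /=.
- move=> /allP ct; rewrite all_map; apply/allP => t tts; exact/IH/ct.
- exact: IH.
- case: eqP => [_ _|nkn ltkn /=]; first exact: tclosed_leq cs.
  by lia.
Qed.

Lemma tunguarded_tsubst i k s t :
  tclosed 0 s -> tunguarded i (tsubst k s t) -> tunguarded i t.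
Proof.
move=> cs; elim/pretype_nested_ind: t i k => [//|t IH|m] i k /=; first exact: IH.
by case: eqP => [_|//]; rewrite (tclosed_tunguarded _ cs).
Qed.

Lemma contractive_tsubst k s t :
  tclosed 0 s -> contractive s -> contractive t -> contractive (tsubst k s t).
Proof.
move=> cs gs; elim/pretype_nested_ind: t k => [ts a IH|t IH|m] k /=.
- move=> /allP ct; rewrite all_map; apply/allP => t tts; exact/IH/ct.
- move=> /andP[ug gt]; rewrite IH // andbT; apply: contra ug.
  exact: tunguarded_tsubst.
- by case: eqP.
Qed.

(** Termination measure for unfolding: when the body is guarded, substitution creates no new leading
    binder, so each unfolding of a contractive type removes exactly one. *)
Fixpoint head_mus (t : pretype) : nat :=
  if t is TMu t then (head_mus t).+1 else 0.

Lemma head_mus_tsubst k s t :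
  ~~ tunguarded k t -> head_mus (tsubst k s t) = head_mus t.
Proof.
elim/pretype_nested_ind: t k => [//|t IH|m] k /=; first by move=> /IH->.
by move/negPf->.
Qed.

Definition wf_pretype (t : pretype) : bool := tclosed 0 t && contractive t.

Lemma wf_tunfold t : wf_pretype t ->
  exists ts a, tunfold t ts a /\ {in ts, forall u, wf_pretype u}.
Proof.
move: {2}(head_mus t) (erefl (head_mus t)) => n.
elim: n t => [|n IH] [ts a|t|m] //=.
- move=> _ /andP[/allP ct /allP gt]; exists ts, a; split; first exact: tunfold_chan.
  by move=> u uts; apply/andP; split; [exact: ct | exact: gt].
- move=> [hmt] /andP[/= ct /andP[ug gt]].
  have [||ts [a [ut wts]]] := IH (tsubst 0 (TMu t) t).
  + by rewrite head_mus_tsubst.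
  + by rewrite /wf_pretype tclosed_tsubst ?contractive_tsubst //= ug.
  + by exists ts, a; split=> //; apply: tunfold_mu.
Qed.

(** The observer can allocate only at types with an explicit channel constructor, so [T] is exposed
    in that form to let the observer create a value of type [T]. *)
Lemma ctype_unfold (T : ctype) :
  exists ts a, type_eq (tchan ts a) (TU T).
Proof.
have [ts [a [uT wts]]] := wf_tunfold (valP T).
have [us Eus] : exists us : seq ctype, map val us = ts.
  elim: ts wts {uT} => [|t ts IH] wts; first by exists [::].
  have [|us Eus] := IH; first by move=> u uts; apply: wts; rewrite inE uts orbT.
  exists (exist _ t (wts t (mem_head t ts)) :: us); by rewrite /= Eus.
exists us, a; rewrite /type_eq /= Eus.
(* Equality on well-formed pretypes is a tree bisimulation, since each of them unfolds into
   well-formed arguments; the single extra pair has the same unfolding on both sides. *)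
exists (fun t u => (t = u /\ wf_pretype t) \/ (t = TChan ts a /\ u = val T));
  last by right.
move=> t u [[<- wt]|[-> ->]].
- have [ts' [a' [ut wts']]] := wf_tunfold wt; exists ts', ts', a'; split=> //.
  by move=> i ilt; left; split=> //; apply: wts'; rewrite mem_nth.
- exists ts, ts, a; split=> //; first exact: tunfold_chan.
  by move=> i ilt; left; split=> //; apply: wts; rewrite mem_nth.
Qed.

Lemma attr_sub_unq0 a : attr_sub (Unq 0) a.
Proof.
case: a => [||i]; first exact: attr_sub_unq.
- exact: attr_sub_trans (attr_sub_unq 0) attr_sub_aff.
- elim: i => [|i IH]; first exact: attr_sub_refl.
  exact: attr_sub_trans IH (attr_sub_index i).
Qed.

Lemma assume1 u T : assume [:: u] [:: T] = [mset (u, TU T)].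
Proof.
by apply/msetP => p; rewrite /assume /= mset_seqE msetnE /= addn0 eq_sym; case: eqP.
Qed.

(** * Credits *)

(* Only channel constants occur as subjects of unary prefixes; the prefixes
   whose subject is a variable are never unary, hence cannot be instantiated to
   an observable action on [cin] or [cout]. *)
Inductive credit (cin cout : channel) : nat -> proc -> Prop :=
| credit_in1 n c x P : c != cout -> credit cin cout (n + (c == cin)) P ->
    credit cin cout n (PIn (Ch c) [:: x] P)
| credit_in n u xs P : size xs != 1 -> credit cin cout n P ->
    credit cin cout n (PIn u xs P)
| credit_out1 n c v P : c != cin -> credit cin cout n P ->
    credit cin cout (n + (c == cout)) (POut (Ch c) [:: v] P)
| credit_out n u vs P : size vs != 1 -> credit cin cout n P ->
    credit cin cout n (POut u vs P)
| credit_nil : credit cin cout 0 PNil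
| credit_par n1 n2 P Q : credit cin cout n1 P -> credit cin cout n2 Q ->
    credit cin cout (n1 + n2) (PPar P Q)
| credit_rec w P : credit cin cout 0 P -> credit cin cout 0 (PRec w P)
| credit_var w : credit cin cout 0 (PVar w)
| credit_alloc n x P : credit cin cout n P -> credit cin cout n.+1 (PAlloc x P)
| credit_free n u P : credit cin cout n.+1 P -> credit cin cout n (PFree u P).

Lemma credit_prename cin cout r n P :
    injective r -> r cin = cin -> r cout = cout ->
  credit cin cout n P -> credit cin cout n (prename r P).
Proof.
move=> rI rin rout.
have r_cin c : (r c == cin) = (c == cin) by rewrite -{1}rin (inj_eq rI).
have r_cout c : (r c == cout) = (c == cout) by rewrite -{1}rout (inj_eq rI).
elim=> {n P} /=; try by constructor.
- move=> n c x P cout_c _ IH; apply: credit_in1; first by rewrite r_cout.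
  by rewrite r_cin.
- move=> n c v P cin_c _ IH; rewrite -r_cout.
  by apply: credit_out1; rewrite ?r_cin.
- by move=> n u vs P sz _ IH; constructor=> //; rewrite size_map.
Qed.

(** Credits look only at arities and at channel constants in subject position, and substitution
    alters neither. *)
Lemma credit_psubst cin cout s n P :
  credit cin cout n P -> credit cin cout n (psubst s P).
Proof.
move=> cP; elim: cP s => {n P} /=; try by constructor; auto.
by move=> n u vs P sz _ IH s; constructor=> //; rewrite size_map.
Qed.

Lemma credit_subst_proc cin cout w Q n P :
    credit cin cout 0 Q ->
  credit cin cout n P -> credit cin cout n (subst_proc w Q P).
Proof.
by move=> cQ; elim=> {n P} /=; intros; try case: ifP => _ //; constructor.
Qed.

Lemma credit_inv cin cout n P : credit cin cout n P ->
  match P with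
  | POut u vs P => exists2 m, credit cin cout m P &
      if vs is [:: _] then exists2 c, u = Ch c & c != cin /\ n = m + (c == cout)
      else n = m
  | PIn u xs P => exists2 m, credit cin cout m P &
      if xs is [:: _] then exists2 c, u = Ch c & c != cout /\ m = n + (c == cin)
      else n = m
  | PNil | PVar _ => n = 0
  | PIf _ _ _ _ => False
  | PRec _ P => n = 0 /\ credit cin cout 0 P
  | PPar P Q => exists n1 n2,
      [/\ credit cin cout n1 P, credit cin cout n2 Q & n = n1 + n2]
  | PAlloc _ P => exists2 m, credit cin cout m P & n = m.+1
  | PFree _ P => credit cin cout n.+1 P
  end.
Proof.
case=> {n P} //.
- by move=> n c x P cc cP; exists (n + (c == cin)) => //; exists c.
- by move=> n u [|x [|y xs]] P // _ cP; exists n.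
- by move=> n c v P cc cP; exists n => //; exists c.
- by move=> n u [|x [|y xs]] P // _ cP; exists n.
- by move=> n1 n2 P Q; exists n1, n2.
- by move=> n x P; exists n.
Qed.

(** The part of the credit change fixed by the label, which both players share. At [LAlloc] and
    [LFree] it cancels the cost of the observer's own move, since that move leaves the process
    alone. *)
Definition gain (cin cout : channel) (mu : label) : int :=
  match mu with
  | LIn c [:: _] => (c == cin : nat)%:Z
  | LOut c [:: _] => (- (c == cout : nat)%:Z)%R
  | LAlloc => 1
  | LFree _ => (-1)%R
  | _ => 0
  end.

(* Both players of a communication on [c] see a neutral label: the sender has
   [c != cin] and the receiver [c != cout]. *)
Lemma credit_pretrans cin cout X mu k Y n :
    pretrans X mu k Y -> credit cin cout n (cproc X) ->
  exists2 m : nat, credit cin cout m (cproc Y) &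
    (m%:Z = n%:Z + gain cin cout mu - k)%R /\
    match mu with
    | LIn c [:: _] => c != cout
    | LOut c [:: _] => c != cin
    | _ => true
    end.
Proof.
move=> st; elim: st n => {X mu k Y} /=.
- move=> G D M c ts a ds P _ _ n /credit_inv[m cm].
  case: ds => [|d0 [|d1 ds]] /= e; exists m => //; try by split=> //; lia.
  by case: e => _ [<-] [? ->]; split=> //; lia.
- move=> G D M c ts a ds xs P _ _ sz n /credit_inv[m cm e].
  exists m; first exact: credit_psubst.
  case: xs ds e sz => [|x0 [|x1 xs]] [|d0 [|d1 ds]] //= e _;
    try by split=> //; lia.
  by case: e => _ [<-] [? ->]; split=> //; lia.
- move=> G G1 G1' G2 G2' M c ds P P' Q Q' _ IH1 _ IH2 n.
  move=> /credit_inv[n1 [n2 [/IH1[m1 c1 [e1 o1]] /IH2[m2 c2 [e2 o2]] ->]]].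
  exists (m1 + m2); first exact: credit_par.
  split=> //; case: ds e1 o1 e2 o2 {IH1 IH2} => [|d0 [|d1 ds]] /=; lia.
- move=> G G1 G1' G2 G2' M c ds P P' Q Q' _ IH1 _ IH2 n.
  move=> /credit_inv[n1 [n2 [/IH1[m1 c1 [e1 o1]] /IH2[m2 c2 [e2 o2]] ->]]].
  exists (m1 + m2); first exact: credit_par.
  split=> //; case: ds e1 o1 e2 o2 {IH1 IH2} => [|d0 [|d1 ds]] /=; lia.
- move=> G G' M M' P P' Q mu k _ IH n.
  move=> /credit_inv[n1 [n2 [/IH[m cm [e o]] cQ ->]]].
  by exists (m + n2); [exact: credit_par | split=> //; lia].
- move=> G G' M M' P Q Q' mu k _ IH n.
  move=> /credit_inv[n1 [n2 [cP /IH[m cm [e o]] ->]]].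
  by exists (n1 + m); [exact: credit_par | split=> //; lia].
- by move=> G G' M P _ n cP; exists n => //; split=> //; lia.
- move=> G M w P n cP; have [n0 cP0] := credit_inv cP; subst n.
  by exists 0; [exact: credit_subst_proc | split=> //; lia].
- by move=> G M c P Q _ n /credit_inv.
- by move=> G M c d P Q _ _ _ n /credit_inv.
- move=> G M c x P _ n /credit_inv[m cm ->].
  by exists m; [exact: credit_psubst | split=> //; lia].
- by move=> G M c ts P _ n cP; exists n => //; split=> //; lia.
- by move=> G M c P _ n /credit_inv cP; exists n.+1 => //; split=> //; lia.
- by move=> G M c ts P _ n cP; exists n => //; split=> //; lia.
Qed.

(** A transition may first rename channels outside the environment; this condition makes every such
    renaming fix [cin] and [cout], so that credits survive it. *)
Definition observes (cin cout : channel) (G : env) : Prop :=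
  dom G (Ch cin) /\ dom G (Ch cout).

Lemma observes_Gext cin cout T G : observes cin cout (Gext cin cout T `+` G).
Proof.
by split; exists (tchan [:: T] Unr); rewrite !in_msetD !in_mset1 eqxx ?orbT.
Qed.

Lemma credit_trans cin cout X mu k Y n :
    observes cin cout (cenv X) -> trans X mu k Y -> credit cin cout n (cproc X) ->
  exists2 m : nat, credit cin cout m (cproc Y) &
    (m%:Z = n%:Z + gain cin cout mu - k)%R.
Proof.
move=> [din dout] [r [rB rfix st]] cX.
have cr := credit_prename (bij_inj rB) (rfix _ din) (rfix _ dout) cX.
by have [m cm [e _]] := credit_pretrans st cr; exists m.
Qed.

Lemma pretrans_tau_env X mu k Y : pretrans X mu k Y -> mu = LTau -> cenv Y = cenv X.
Proof. by elim=> {X mu k Y}. Qed.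

Lemma taus_env X k Y : taus X k Y -> cenv Y = cenv X.
Proof.
elim=> {X k Y} [//|X Y Z k l [r [_ _ st]] _ ->].
by rewrite (pretrans_tau_env st).
Qed.

Lemma credit_taus cin cout X k Y n :
    observes cin cout (cenv X) -> taus X k Y -> credit cin cout n (cproc X) ->
  exists2 m : nat, credit cin cout m (cproc Y) & (m%:Z = n%:Z - k)%R.
Proof.
move=> + st; elim: st n => {X k Y} [X|X Y Z k l st _ IH] n oX cX.
  by exists n => //; lia.
have [m cm e] := credit_trans oX st cX.
have [|m' cm' e'] := IH m _ cm.
  by have [r [_ _ pst]] := st; rewrite (pretrans_tau_env pst).
exists m' => //; move: e; rewrite /=; lia.
Qed.

Lemma credit_weak_hat cin cout X mu k Y n :
    observes cin cout (cenv X) -> observes cin cout (cenv Y) ->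
    weak_hat X mu k Y -> credit cin cout n (cproc X) ->
  exists2 m : nat, credit cin cout m (cproc Y) &
    (m%:Z = n%:Z + gain cin cout mu - k)%R.
Proof.
move=> oX oY wXY cX; have [E|Nmu] := pselect (mu = LTau).
  subst mu; have [m cm e] := credit_taus oX wXY cX.
  by exists m => //; rewrite /=; lia.
have {wXY} : weak X mu k Y by case: mu wXY Nmu.
move=> [X' [Y' [k1 [k2 [k3 [t1 st t2 ->]]]]]].
have [m1 c1 e1] := credit_taus oX t1 cX.
have [|m2 c2 e2] := credit_trans _ st c1; first by rewrite (taus_env t1).
have [|m3 c3 e3] := credit_taus _ t2 c2; first by rewrite -(taus_env t2).
by exists m3 => //; lia.
Qed.

(** The books balance in each half separately: the front pays for its allocation with the input on
    [cin], and the back pays for its output on [cout] with the deallocation. *)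
Lemma credit_eBuff cin cout b d c1 : uniq [:: cin; cout; b; d; c1] ->
  credit cin cout 0 (eBuff cin cout b d c1).
Proof.
rewrite /= !inE !negb_or.
move=> /andP[/and4P[io ib id _] /andP[/and3P[ob od _] _]].
have eqs : [/\ (b == cin) = false, (b == cout) = false,
               (d == cin) = false & (d == cout) = false].
  by rewrite !(eq_sym b) !(eq_sym d); split; apply/negbTE.
have [b_in b_out d_in d_out] := eqs; have iof := negbTE io.
have out_nil c v : c != cin -> (c == cout) = false ->
    credit cin cout 0 (POut (Ch c) [:: v] PNil).
  move=> ci co; have := @credit_out1 cin cout 0 c v PNil ci (credit_nil _ _).
  by rewrite co.
have out_cout v P : credit cin cout 0 P ->
    credit cin cout 1 (POut (Ch cout) [:: v] P).
  move=> cP; have := @credit_out1 cin cout 0 cout v P _ cP.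
  by rewrite eqxx eq_sym; apply.
have par0 P Q : credit cin cout 0 P -> credit cin cout 0 Q ->
    credit cin cout 0 (PPar P Q).
  exact: (@credit_par cin cout 0 0).
have in_cin x P : credit cin cout 1 P ->
    credit cin cout 0 (PIn (Ch cin) [:: x] P).
  by move=> cP; constructor; rewrite ?iof ?eqxx.
have in_neq c x P : (c == cin) = false -> (c == cout) = false ->
    credit cin cout 0 P -> credit cin cout 0 (PIn (Ch c) [:: x] P).
  by move=> ci co cP; constructor; rewrite ?ci ?co.
have cFrn : credit cin cout 0 (Frn cin b).
  constructor; apply/in_neq => //; apply/in_cin; apply: credit_alloc.
  apply/par0; first by apply/par0; [constructor | apply/out_nil; rewrite ?b_in].
  by apply: credit_out => //; constructor.
have ceBk : credit cin cout 0 (eBk cout d).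
  constructor; apply/in_neq => //; apply: credit_in => //; apply: credit_free.
  apply/out_cout; apply/par0; [constructor | apply/out_nil; rewrite ?d_in //].
apply/par0.
  apply/in_cin; apply: credit_alloc; apply/par0.
    by apply/par0 => //; apply/out_nil; rewrite ?b_in.
  by apply: credit_out => //; constructor.
apply: credit_in => //; apply: credit_free; apply/out_cout; apply/par0 => //.
by apply/out_nil; rewrite ?d_in.
Qed.

(** * Playing against a bisimulation *)

(** The answering system stays existential, because only the sum [K] of its credit and the
    amortisation credit matters. Both summands are naturals, so a negative [K] is a
    contradiction. *)
Definition play (cin cout : channel) (R : env -> nat -> system -> system -> Prop)
    (K : int) (G : env) (M : set channel) (P : proc) : Prop :=
  observes cin cout G /\
  exists n m S, [/\ R G n (Sys M P) S, credit cin cout m (sproc S) &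
                    (n%:Z + m%:Z)%R = K].

Lemma play_ge0 cin cout R K G M P : play cin cout R K G M P -> (0 <= K)%R.
Proof. by move=> [_ [n [m [S [_ _ <-]]]]]; lia. Qed.

(** Every system related by a bisimulation is well formed, so an unallocated channel can be read off
    from [R] at any point of the run. *)
Lemma play_fresh cin cout R K G M P :
  amortised_bisimulation R -> play cin cout R K G M P -> exists c, ~ M c.
Proof.
move=> bR [_ [n [m [S [RnS _ _]]]]].
have [[[/= infM _] _ _] _ _ _] := bR _ _ _ _ RnS.
apply: contrapT => /forallNP allM; apply: infM.
suff -> : (~` M = set0)%classic by exact: finite_set0.
by rewrite predeqE => c; split=> // nMc; case: (allM c).
Qed.

Lemma irename_id u : irename id u = u. Proof. by case: u. Qed.

Lemma prename_id P : prename id P = P.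
Proof.
have mapE vs : map (irename id) vs = vs.
  by rewrite (eq_map irename_id) map_id.
by elim: P => //= *; rewrite ?irename_id ?mapE; congruence.
Qed.

Lemma pretrans_trans X mu k Y : pretrans X mu k Y -> trans X mu k Y.
Proof.
case: X => G M P st; exists id; split=> //; first exact: (Bijective (g := id)).
by rewrite /= prename_id image_id.
Qed.

(** If the answer costs [l], the amortisation credit changes by [l - k] and the syntactic credit by
    the gain minus [l]; in the sum [l] cancels, whatever the answer was. *)
Lemma play_step cin cout R mu k G' M' P' K G M P :
    amortised_bisimulation R -> observes cin cout G' ->
    play cin cout R K G M P ->
    pretrans (Conf G M P) mu k (Conf G' M' P') ->
  play cin cout R (K + gain cin cout mu - k)%R G' M' P'.
Proof.
move=> bR oG' [oG [n [m [S [RnS cm <-]]]]] st; split=> //.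
have [_ _ fwd _] := bR _ _ _ _ RnS.
have [l [S' [n' [wk en' RS']]]] := fwd mu k G' (Sys M' P') (pretrans_trans st).
have [m' cm' em'] := credit_weak_hat (X := sconf G S) (Y := sconf G' S') oG oG' wk cm.
by exists n', m', S'; split=> //; lia.
Qed.

Lemma play_tau cin cout R k M' P' K G M P :
    amortised_bisimulation R -> play cin cout R K G M P ->
    pretrans (Conf G M P) LTau k (Conf G M' P') ->
  play cin cout R (K - k)%R G M' P'.
Proof.
move=> bR pl st; have := play_step bR pl.1 pl st.
by rewrite /= addr0.
Qed.

Lemma play_tau0 cin cout R M' P' K G M P :
    amortised_bisimulation R -> play cin cout R K G M P ->
    pretrans (Conf G M P) LTau 0%R (Conf G M' P') ->
  play cin cout R K G M' P'.
Proof. by move=> bR pl st; have := play_tau bR pl st; rewrite subr0. Qed.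

(** * The run of the leaky buffer *)

(** The communication rule leaves the environments of the two partners arbitrary, so the subject
    channel may be taken unrestricted with every argument at the same type [T]. *)
Lemma pretrans_com_out M c ds P (T : ctype) :
  exists G G', pretrans (Conf G M (POut (Ch c) (map Ch ds) P)) (LOut c ds) 0%R
                        (Conf G' M P).
Proof.
exists (mset0 `+` [mset (Ch c, tchan (nseq (size ds) T) Unr)]).
by eexists; apply: pt_out; rewrite ?size_nseq.
Qed.

Lemma pretrans_com_in M c ds xs P (T : ctype) : size ds = size xs ->
  exists G G', pretrans (Conf G M (PIn (Ch c) xs P)) (LIn c ds) 0%R
                        (Conf G' M (subst_chans xs ds P)).
Proof.
move=> sz; exists (mset0 `+` [mset (Ch c, tchan (nseq (size ds) T) Unr)]
                     `+` assume (map Ch ds) (nseq (size ds) T)).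
by eexists; apply: pt_in; rewrite ?size_nseq.
Qed.

(* Every exhausted output leaves a [PNil] in parallel. *)
Definition pad (j : nat) (P : proc) : proc := iter j (PPar^~ PNil) P.

Lemma pretrans_pad j G M P mu k G' M' P' :
    pretrans (Conf G M P) mu k (Conf G' M' P') ->
  pretrans (Conf G M (pad j P)) mu k (Conf G' M' (pad j P')).
Proof. by move=> st; elim: j => [//|j IH]; apply: pt_par_l. Qed.

(** The run alternates between two shapes. In the read shape both halves hold the current link [x];
    in the ready shape both recursions are folded and the next link [c] is on offer at [b] and
    [d]. *)
Definition frn_read (cin b x : channel) : proc :=
  PIn (Ch cin) [:: vy] (PAlloc vz
    (PPar (PPar (Frn cin b) (POut (Ch b) [:: Va vz] PNil))
         (POut (Ch x) [:: Va vy; Va vz] PNil))).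

Definition bck_read (cout d x : channel) : proc :=
  PIn (Ch x) [:: vy; vz] (POut (Ch cout) [:: Va vy]
    (PPar (Bck cout d) (POut (Ch d) [:: Va vz] PNil))).

Definition frn_ready (cin b c : channel) : proc :=
  PPar (Frn cin b) (POut (Ch b) [:: Ch c] PNil).

Definition bck_ready (cout d c : channel) : proc :=
  PPar (Bck cout d) (POut (Ch d) [:: Ch c] PNil).

(** Input, allocation, communication on [x] and output change the sum by 1, -1, 0 and -1. The value
    [v] leaves the environment at the input and returns at the output. *)
Lemma play_cycle cin cout b d (T : ctype) R K M v x i j :
    amortised_bisimulation R ->
    play cin cout R K (Gext cin cout T `+` [mset (Ch v, TU T)]) M
      (PPar (pad i (frn_read cin b x)) (pad j (bck_read cout d x))) ->
  exists c M', play cin cout R (K - 1)%R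
      (Gext cin cout T `+` [mset (Ch v, TU T)]) M'
      (PPar (pad i.+1 (frn_ready cin b c)) (pad j (bck_ready cout d c))).
Proof.
set G := _ `+` _ => bR pl.
have oext : observes cin cout (Gext cin cout T).
  by rewrite -[Gext _ _ _]msetD0; apply: observes_Gext.
have {}pl : play cin cout R (K + 1)%R (Gext cin cout T) M
    (PPar (pad i (PAlloc vz
      (PPar (PPar (Frn cin b) (POut (Ch b) [:: Va vz] PNil))
            (POut (Ch x) [:: Ch v; Va vz] PNil)))) (pad j (bck_read cout d x))).
  have := @play_step cin cout R (LIn cin [:: v]) 0%R _ _ _ _ _ _ _ bR oext pl.
  rewrite /gain eqxx subr0; apply.
  apply/pt_par_l/pretrans_pad.
  have -> : G = [mset (Ch cout, tchan [:: T] Unr)]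
      `+` [mset (Ch cin, tchan [:: T] Unr)] `+` assume (map Ch [:: v]) [:: T].
    by rewrite /G /Gext /= assume1 (msetDC [mset (Ch cin, _)]).
  rewrite /Gext (msetDC [mset (Ch cin, _)]).
  exact: (@pt_in _ [mset (Ch cin, tchan [:: T] Unr)]).
have [c nMc] := play_fresh bR pl.
have {}pl : play cin cout R K (Gext cin cout T) (c |` M)%classic
    (PPar (pad i (PPar (frn_ready cin b c) (POut (Ch x) [:: Ch v; Ch c] PNil)))
          (pad j (bck_read cout d x))).
  have -> : K = (K + 1 - 1)%R by lia.
  apply: play_tau bR pl _; apply/pt_par_l/pretrans_pad; exact: pt_alloc.
have {}pl : play cin cout R K (Gext cin cout T) (c |` M)%classic
    (PPar (pad i.+1 (frn_ready cin b c))
          (pad j (POut (Ch cout) [:: Ch v] (bck_ready cout d c)))).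
  apply: play_tau0 bR pl _.
  have [G1 [G1' st1]] := pretrans_com_out (c |` M)%classic x [:: v; c] PNil T.
  have [//|G2 [G2' st2]] := @pretrans_com_in (c |` M)%classic x [:: v; c]
    [:: vy; vz] (POut (Ch cout) [:: Va vy]
      (PPar (Bck cout d) (POut (Ch d) [:: Va vz] PNil))) T.
  (* The spent output leaves its [PNil] innermost, so the padding is unrolled from the inside. *)
  rewrite /pad iterSr.
  apply: (pt_com_l _ (pretrans_pad i (pt_par_r _ st1)) (pretrans_pad j st2)).
exists c, (c |` M)%classic.
have oG : observes cin cout G by apply: observes_Gext.
have := @play_step cin cout R (LOut cout [:: v]) 0%R _ _ _ _ _ _ _ bR oG pl.
rewrite /gain eqxx subr0; apply.
apply/pt_par_r/pretrans_pad.
rewrite /G -assume1.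
exact: (@pt_out _ [mset (Ch cout, tchan [:: T] Unr)] _ _ [:: T] Unr [:: v]).
Qed.

(** Four silent moves of cost 0: both recursions unfold, then each half receives [c] from its own
    pending output, which leaves one [PNil] behind. *)
Lemma play_ready cin cout b d (T : ctype) R K G M c i j :
    amortised_bisimulation R ->
    play cin cout R K G M
      (PPar (pad i (frn_ready cin b c)) (pad j (bck_ready cout d c))) ->
  play cin cout R K G M
    (PPar (pad i.+1 (frn_read cin b c)) (pad j.+1 (bck_read cout d c))).
Proof.
move=> bR pl.
have {}pl := play_tau0 bR pl
  (pt_par_l _ (pretrans_pad i (pt_par_l _ (pt_rec _ _ _ _)))).
have {}pl := play_tau0 bR pl
  (pt_par_r _ (pretrans_pad j (pt_par_l _ (pt_rec _ _ _ _)))).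
have [Gb [Gb' outb]] := pretrans_com_out M b [:: c] PNil T.
have [Gd [Gd' outd]] := pretrans_com_out M d [:: c] PNil T.
have [//|Gb2 [Gb2' inb]] := @pretrans_com_in M b [:: c] [:: vx]
  (PIn (Ch cin) [:: vy] (PAlloc vz
    (PPar (PPar (Frn cin b) (POut (Ch b) [:: Va vz] PNil))
         (POut (Va vx) [:: Va vy; Va vz] PNil)))) T.
have [//|Gd2 [Gd2' ind]] := @pretrans_com_in M d [:: c] [:: vx]
  (PIn (Va vx) [:: vy; vz] (POut (Ch cout) [:: Va vy]
    (PPar (Bck cout d) (POut (Ch d) [:: Va vz] PNil)))) T.
have {}pl := play_tau0 bR pl
  (pt_par_l _ (pretrans_pad i (pt_com_r _ inb outb))).
have {}pl := play_tau0 bR pl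
  (pt_par_r _ (pretrans_pad j (pt_com_r _ ind outd))).
by rewrite /pad !iterSr.
Qed.

(** Each round returns to the read shape with the sum lowered by one; from 0 it would become
    negative. The link, the resources and the padding vary from round to round. *)
Lemma not_play_read cin cout b d (T : ctype) R (K : nat) M v x i j :
    amortised_bisimulation R ->
  ~ play cin cout R K%:Z (Gext cin cout T `+` [mset (Ch v, TU T)]) M
      (PPar (pad i (frn_read cin b x)) (pad j (bck_read cout d x))).
Proof.
move=> bR; elim: K M x i j => [|K IH] M x i j /(play_cycle bR)[c [M' pl]].
  by have := play_ge0 pl.
have {}pl := play_ready T bR pl.
have eK : (K.+1%:Z - 1 = K%:Z)%R by lia.
by move: pl; rewrite eK; apply: IH.
Qed.

Theorem theorem6p3 (cin cout b d c1 : channel)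
    (chans_distinct : uniq [:: cin; cout; b; d; c1])
    (T : ctype) (M : set channel) (hM : resource_env M)
    (chans_alloc : forall c, c \in [:: cin; cout; b; d; c1] -> M c)
    (n : nat) :
  ~ bis_le (Gext cin cout T) n
      (Sys M (Buff cin cout b d c1)) (Sys M (eBuff cin cout b d c1)).
Proof.
move=> [R bR RBuff].
have pl : play cin cout R n%:Z (Gext cin cout T) M (Buff cin cout b d c1).
  split; first by rewrite -[Gext _ _ _]msetD0; apply: observes_Gext.
  exists n, 0, (Sys M (eBuff cin cout b d c1)); split=> //; last by lia.
  exact: credit_eBuff.
(* [Gext] need not offer a value of type [T] to send, so the observer allocates one; the gain of
   [LAlloc] offsets the cost. *)
have [v nMv] := play_fresh bR pl.
have [ts [a eqT]] := ctype_unfold T.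
have {}pl := play_step bR (observes_Gext _ _ _ _) pl (pt_ext_alloc _ ts _ nMv).
have st : env_struct (Gext cin cout T `+` [mset (Ch v, tchan ts (Unq 0))])
                     (Gext cin cout T `+` [mset (Ch v, TU T)]).
  (* The unique attribute is below [a]; once it is weakened to [a], type equality folds the
     unfolding back into [T]. *)
  apply: es_trans (es_eq _ _ eqT); apply: es_sub.
  by constructor; apply: attr_sub_unq0.
have {}pl := play_step bR (observes_Gext _ _ _ _) pl (pt_env _ _ st).
(* [Buff] is by computation the read shape with link [c1] and no padding. *)
apply: (@not_play_read cin cout b d T R n (v |` M)%classic v c1 0 0 bR).
have en : (n%:Z + 1 - 1 + 0 - 0 = n%:Z)%R by lia.
by move: pl; rewrite en.
Qed.
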